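(* For $n\ge 1$, let $p_c:\mathrm{GF}(2)^n\to\mathrm{GF}(2)$ be the clique function in $n$ variables, $p_c(\mathbf{x})=\sum_{0\le i<j\le n-1}x_ix_j$, and let $K_n$ be the number of flat spectra of $p_c$ with respect to $\{H,N\}^n$. Then $K_n=K_{n-1}+1+(-1)^n$ for all $n\ge 2$, and in closed form $$K_n=n+\frac{1+(-1)^n}{2}\qquad(n\ge 1).$$
   Context: Let $I$ be the $2\times 2$ identity matrix, $H=\frac{1}{\sqrt2}\begin{pmatrix}1&1\\1&-1\end{pmatrix}$, and $N=\frac{1}{\sqrt2}\begin{pmatrix}1&i\\1&-i\end{pmatrix}$ with $i^2=-1$. For $S\subseteq\{I,H,N\}$, $S^n$ denotes the set of $|S|^n$ transforms $U=U_0\otimes U_1\otimes\cdots\otimes U_{n-1}$ with each $U_j\in S$ (the factor $U_j$ acts on the tensor position of variable $x_j$); each transform is identified with the choice $(U_0,\ldots,U_{n-1})$. For a Boolean function $p:\mathrm{GF}(2)^n\to\mathrm{GF}(2)$, let $(-1)^{p}\in\mathbb{C}^{2^n}$ be the vector with entries $(-1)^{p(\mathbf{x})}$ indexed by $\mathbf{x}=(x_0,\ldots,x_{n-1})\in\mathrm{GF}(2)^n$. The spectrum of $p$ with respect to $U$ is $P=U(-1)^p=(P_{\mathbf{k}})_{\mathbf{k}\in\mathrm{GF}(2)^n}$, and it is flat if $|P_{\mathbf{k}}|=1$ for all $\mathbf{k}$. The number of flat spectra of $p$ with respect to $S^n$ is the number of choices $(U_0,\ldots,U_{n-1})\in S^n$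 for which the spectrum of $p$ is flat. *)

(* Defs.v *)
From HB Require Import structures.
From mathcomp Require Import all_boot all_order all_algebra.
From mathcomp Require Export reals complex.

Set Implicit Arguments.
Unset Strict Implicit.
Unset Printing Implicit Defensive.

Import GRing.Theory Num.Theory.
Local Open Scope ring_scope.

(* Names of the three one-variable transforms.  Choices (U_0, ..., U_(n-1)) are
   counted as tuples of names; the 2 x 2 matrices are attached by [gate_mx]. *)
Inductive gate := GateI | GateH | GateN.

Definition gate_to_ord (g : gate) : 'I_3 :=
  match g with GateI => inord 0 | GateH => inord 1 | GateN => inord 2 end.

Definition gate_of_ord (i : 'I_3) : gate := nth GateI [:: GateI; GateH; GateN] i.

Lemma gate_to_ordK : cancel gate_to_ord gate_of_ord.
Proof. by case; rewrite /gate_of_ord /= inordK. Qed.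

HB.instance Definition _ := Finite.copy gate (can_type gate_to_ordK).

Section Spectra.
Variable C : numClosedFieldType.

Definition mx2 (a b c d : C) : 'M[C]_2 :=
  \matrix_(i, j) nth 0 (nth [::] [:: [:: a; b]; [:: c; d]] i) j.

Definition gate_mx (g : gate) : 'M[C]_2 :=
  match g with
  | GateI => 1%:M
  | GateH => (sqrtC 2)^-1 *: mx2 1 1 1 (- 1)
  | GateN => (sqrtC 2)^-1 *: mx2 1 'i 1 (- 'i)
  end.

(* Entry (k, x) of U_0 \otimes ... \otimes U_(n-1), with rows and columns indexed
   by GF(2)^n.  A bit in 'F_2 is used directly as an index in 'I_2, to which
   'F_2 is convertible. *)
Definition tensor_entry n (U : {ffun 'I_n -> gate}) (k x : 'rV['F_2]_n) : C :=
  \prod_(j < n) gate_mx (U j) (k 0 j) (x 0 j).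

Definition spectrum n (U : {ffun 'I_n -> gate}) (p : 'rV['F_2]_n -> 'F_2)
    (k : 'rV['F_2]_n) : C :=
  \sum_(x : 'rV['F_2]_n) tensor_entry U k x * (- 1) ^+ (p x : nat).

Definition flat n (U : {ffun 'I_n -> gate}) (p : 'rV['F_2]_n -> 'F_2) : bool :=
  [forall k : 'rV['F_2]_n, `|spectrum U p k| == 1].

Definition num_flat_spectra n (S : {set gate}) (p : 'rV['F_2]_n -> 'F_2) : nat :=
  #|[set U : {ffun 'I_n -> gate} | [forall j, U j \in S] && flat U p]|.

End Spectra.

Definition clique n (x : 'rV['F_2]_n) : 'F_2 :=
  \sum_(i < n) \sum_(j < n | (i < j)%N) x 0 i * x 0 j.

Definition K (R : realType) (n : nat) : nat :=
  num_flat_spectra R[i] [set GateH; GateN] (@clique n).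

(* Main.v *)
Require Import Defs.
From mathcomp Require Import all_boot all_order all_algebra.
From mathcomp Require Import reals.
From mathcomp Require Import ring.

Local Open Scope ring_scope.

(** With w the weight of x, the clique function takes the value binomial(w, 2)
    mod 2, and (-1)^binomial(w, 2) = ((1 - i) i^w + (1 + i) (-i)^w) / 2.  So each
    entry of the spectrum is (A + B) / 2 with A and B products over the tensor
    positions.  Up to 1 / sqrt 2, a position with H contributes 1 + i or 1 - i to
    A and B, and a position with N contributes 0 to one of them and 2 to the
    other.  Hence two N's give a zero entry, a single N always gives a flat
    spectrum, and for no N the identity ((A + B) / 2)^2 = 1 + (A^2 + B^2) / 4
    shows that flatness depends on the parity of n only. *)

Import GRing.Theory Num.Theory.

Section CliqueSpectrum.
Set Implicit Arguments.
Unset Strict Implicit.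
Variable C : numClosedFieldType.
Implicit Types (g : gate) (a b : 'F_2) (z : C).

Lemma F2_cases a : a = 0 \/ a = 1.
Proof. by case: a => [[|[|//]] h]; [left|right]; apply: val_inj. Qed.

Lemma signF2D a b :
  (-1) ^+ ((a + b)%R : 'F_2) = (-1) ^+ (a : nat) * (-1) ^+ (b : nat) :> C.
Proof.
by case: (F2_cases a) => ->; case: (F2_cases b) => ->; rewrite /= ?expr0 ?expr1; ring.
Qed.

Lemma signF2_sum (I : finType) (f : I -> 'F_2) :
  (-1) ^+ ((\sum_i f i)%R : 'F_2) = \prod_i (-1) ^+ (f i : nat) :> C.
Proof. by apply: (big_morph (fun a : 'F_2 => (-1) ^+ (a : nat)) signF2D). Qed.

Lemma sum_pairs_recr n (f : 'I_n.+1 -> 'F_2) :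
  \sum_(i < n.+1) \sum_(j < n.+1 | (i < j)%N) f i * f j =
  \sum_(i < n) \sum_(j < n | (i < j)%N)
     f (widen_ord (leqnSn n) i) * f (widen_ord (leqnSn n) j)
  + (\sum_(i < n) f (widen_ord (leqnSn n) i)) * f ord_max.
Proof.
rewrite big_ord_recr /= [X in _ + X]big1 ?addr0; last first.
  by move=> j; rewrite ltnNge -ltnS ltn_ord.
rewrite mulr_suml -big_split /=; apply: eq_bigr => i _.
by rewrite big_mkcond big_ord_recr /= ltn_ord -big_mkcond.
Qed.

(** Induction on [n]: if the last bit is 1, the sign gains the factor (-1)^w, with w the weight of
    the other bits. *)
Lemma sign_sum_pairs n (f : 'I_n -> 'F_2) :
  (-1) ^+ ((\sum_(i < n) \sum_(j < n | (i < j)%N) f i * f j)%R : 'F_2) =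
  ((1 - 'i) * \prod_i 'i ^+ (f i : nat)
   + (1 + 'i) * \prod_i (- 'i) ^+ (f i : nat)) / 2 :> C.
Proof.
have i2 := @sqrCi C.
elim: n f => [|n IHn] f; first by rewrite !big_ord0 expr0; field.
rewrite sum_pairs_recr signF2D IHn !big_ord_recr.
set w := widen_ord _.
case: (F2_cases (f ord_max)) => ->; first by rewrite mulr0 /= !expr0 !mulr1.
rewrite mulr1 signF2_sum !expr1.
set P := \prod_i _; set Q := \prod_i _; set t := \prod_i _.
(* Since (-1) i = -i, the factor [t] = (-1)^w swaps the two products. The coefficients match because
   (1 - i) i = 1 + i and (1 + i) (-i) = 1 - i. *)
have tP : t * P = Q.
  by rewrite -big_split /=; apply: eq_bigr => i _; rewrite -exprMn mulN1r.
have tQ : t * Q = P.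
  by rewrite -big_split /=; apply: eq_bigr => i _; rewrite -exprMn mulrNN mul1r.
rewrite mulrAC [_ * t]mulrC mulrDr !(mulrCA t) tP tQ.
by congr (_ / _); rewrite /=; ring: i2.
Qed.

Lemma sum_prod_rV n (F : 'I_n -> 'F_2 -> C) :
  \sum_(x : 'rV['F_2]_n) \prod_j F j (x 0 j) = \prod_j (F j 0 + F j 1).
Proof.
have -> : \prod_j (F j 0 + F j 1) = \prod_j \sum_(a : 'F_2) F j a.
  apply: eq_bigr => j _; rewrite big_ord_recl big_ord1.
  by congr (_ + F j _); apply: val_inj.
rewrite bigA_distr_bigA /=.
rewrite (reindex (fun f : {ffun 'I_n -> 'F_2} => \row_j f j)) /=.
  by apply: eq_bigr => f _; apply: eq_bigr => j _; rewrite mxE.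
exists (fun x : 'rV['F_2]_n => [ffun j => x 0 j]) => [f _|x _].
  by apply/ffunP => j; rewrite ffunE mxE.
by apply/rowP => j; rewrite mxE ffunE.
Qed.

(** Contribution of one tensor position with output bit [a] when an input bit x carries the weight
    z^x; it is used at z = i and z = -i. *)
Definition gate_factor g a z : C := gate_mx C g a 0 + gate_mx C g a 1 * z.

(** The sign is a combination of two functions that are products over the positions, so each of the
    two sums over x factors. *)
Lemma spectrum_clique n (U : {ffun 'I_n -> gate}) (k : 'rV['F_2]_n) :
  spectrum C U (@clique n) k =
  ((1 - 'i) * \prod_j gate_factor (U j) (k 0 j) 'i
   + (1 + 'i) * \prod_j gate_factor (U j) (k 0 j) (- 'i)) / 2.
Proof.
have E z : \prod_j gate_factor (U j) (k 0 j) z =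
    \sum_(x : 'rV['F_2]_n) tensor_entry C U k x * \prod_j z ^+ (x 0 j : nat).
  transitivity (\sum_(x : 'rV['F_2]_n) \prod_j
      (gate_mx C (U j) (k 0 j) (x 0 j) * z ^+ (x 0 j : nat))).
    rewrite (sum_prod_rV (fun j a => gate_mx C (U j) (k 0 j) a * z ^+ (a : nat))).
    by apply: eq_bigr => j _; rewrite /gate_factor expr0 expr1 mulr1.
  by apply: eq_bigr => x _; rewrite big_split.
rewrite !E !mulr_sumr -big_split /= mulr_suml; apply: eq_bigr => x _.
by rewrite /clique (sign_sum_pairs (fun j => x 0 j)); ring.
Qed.

Lemma gate_factorH a z :
  gate_factor GateH a z = (sqrtC 2)^-1 * (1 + (-1) ^+ (a : nat) * z).
Proof.
by case: (F2_cases a) => ->; rewrite /gate_factor !mxE /= ?expr0 ?expr1; ring.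
Qed.

Lemma gate_factorN a z :
  gate_factor GateN a z = (sqrtC 2)^-1 * (1 + (-1) ^+ (a : nat) * ('i * z)).
Proof.
by case: (F2_cases a) => ->; rewrite /gate_factor !mxE /= ?expr0 ?expr1; ring.
Qed.

Lemma norm_eq1_sqr z : (`|z| == 1) = (`|z ^+ 2| == 1).
Proof. by rewrite normrX pexpr_eq1. Qed.

Lemma sqr_invsqrt2 : (sqrtC 2)^-1 ^+ 2 = 2^-1 :> C.
Proof. by rewrite exprVn sqrtCK. Qed.

(** In the square of 1 + s z, with s a sign, the terms 1 and z^2 cancel and only the cross term 2 s
    z is left. *)
Lemma sqr_gate_factorH a z : z ^+ 2 = -1 ->
  gate_factor GateH a z ^+ 2 = (-1) ^+ (a : nat) * z.
Proof.
move=> z2; rewrite gate_factorH exprMn sqr_invsqrt2 sqrrD expr1n mul1r exprMn.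
by rewrite sqrr_sign z2; field.
Qed.

Lemma sqrNCi : (- 'i) ^+ 2 = -1 :> C.
Proof. by rewrite sqrrN sqrCi. Qed.

Lemma norm_gate_factorH a z : z ^+ 2 = -1 -> `|gate_factor GateH a z| = 1.
Proof.
move=> z2; apply/eqP; rewrite norm_eq1_sqr sqr_gate_factorH // normrM normr_sign.
by rewrite mul1r norm_eq1_sqr z2 normrN1.
Qed.

(** [None] stands for H everywhere, so one type with n + 1 elements lists all choices with at most
    one N. *)
Definition single_N {n} (o : option 'I_n) : {ffun 'I_n -> gate} :=
  [ffun i => if o == Some i then GateN else GateH].

Lemma flat_single_N n (j : 'I_n) : flat C (single_N (Some j)) (@clique n).
Proof.
have normH (k : 'rV['F_2]_n) z : z ^+ 2 = -1 ->
    `|\prod_(i | i != j) gate_factor (single_N (Some j) i) (k 0 i) z| = 1.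
  move=> z2; rewrite normr_prod big1 // => i ij.
  by rewrite ffunE (inj_eq Some_inj) eq_sym (negPf ij) norm_gate_factorH.
have i2 := @sqrCi C.
apply/forallP => k; rewrite spectrum_clique.
rewrite !(bigD1 j (P := xpredT)) //= ffunE eqxx !gate_factorN.
have := normH k _ sqrNCi; have := normH k _ (@sqrCi C).
set P := \prod_(i | _) _; set Q := \prod_(i | _) _ => nP nQ.
(* The bit at [j] decides which product vanishes. The coefficient 1 + i or 1 - i of the other, over
   sqrt 2, is itself an H factor, of norm 1. *)
case: (F2_cases (k 0 j)) => ->; rewrite ?expr0 ?expr1.
  have -> : ((1 - 'i) * ((sqrtC 2)^-1 * (1 + 1 * ('i * 'i)) * P) +
     (1 + 'i) * ((sqrtC 2)^-1 * (1 + 1 * ('i * - 'i)) * Q)) / 2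
     = gate_factor GateH 0 'i * Q.
    by rewrite gate_factorH expr0 mulrN -expr2 i2; field; rewrite sqrtC_eq0 pnatr_eq0.
  by rewrite normrM nQ norm_gate_factorH ?mulr1 ?sqrCi.
have -> : ((1 - 'i) * ((sqrtC 2)^-1 * (1 + -1 * ('i * 'i)) * P) +
     (1 + 'i) * ((sqrtC 2)^-1 * (1 + -1 * ('i * - 'i)) * Q)) / 2
     = gate_factor GateH 1 'i * P.
  by rewrite gate_factorH expr1 mulrN -expr2 i2; field; rewrite sqrtC_eq0 pnatr_eq0.
by rewrite normrM nP norm_gate_factorH ?mulr1 ?sqrCi.
Qed.

Lemma not_flat_two_N n (U : {ffun 'I_n -> gate}) (j l : 'I_n) :
  j != l -> U j = GateN -> U l = GateN -> ~~ flat C U (@clique n).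
Proof.
(* For this index, bit 0 at [j] kills the first product and bit 1 at [l] kills the second. *)
move=> jl Uj Ul; apply/negP => /forallP /(_ (\row_i (i == l)%:R)).
rewrite spectrum_clique [X in (_ * X + _)](bigD1 j) //=.
rewrite [X in (_ + _ * X)](bigD1 l) //= Uj Ul !mxE (negPf jl) eqxx.
rewrite !gate_factorN /= expr0 expr1 !mulrN mulN1r opprK mul1r -expr2 sqrCi.
by rewrite subrr !mulr0 !mul0r !mulr0 addr0 mul0r normr0 eq_sym oner_eq0.
Qed.

Lemma sqr_spectrum_all_H n (k : 'rV['F_2]_n) :
  spectrum C (single_N None) (@clique n) k ^+ 2 =
  1 + 'i * ((- 'i) ^+ n - 'i ^+ n) / 2 * \prod_j (-1) ^+ (k 0 j : nat).
Proof.
have i2 := @sqrCi C.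
rewrite spectrum_clique.
set A := \prod_j _; set B := \prod_j _; set E := \prod_j _.
have sqrP z : z ^+ 2 = -1 ->
    (\prod_j gate_factor (single_N None j) (k 0 j) z) ^+ 2 = E * z ^+ n.
  move=> z2; rewrite -prodrXl.
  transitivity (\prod_(j < n) ((-1) ^+ (k 0 j : nat) * z)).
    by apply: eq_bigr => j _; rewrite ffunE sqr_gate_factorH.
  by rewrite big_split prodr_const card_ord.
have A2 : A ^+ 2 = E * 'i ^+ n := sqrP _ i2.
have B2 : B ^+ 2 = E * (- 'i) ^+ n := sqrP _ sqrNCi.
(* Each position contributes (1 + s i) (1 - s i) / 2 = 1. Here [A] and [B] exclude the coefficients
   1 - i and 1 + i, whose squares are -2i and 2i. *)
have AB : A * B = 1.
  rewrite -big_split big1 //= => j _; rewrite ffunE !gate_factorH mulrACA -expr2.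
  rewrite sqr_invsqrt2 mulrN [_ * (_ - _)]mulrC -subr_sqr exprMn.
  rewrite sqrr_sign i2 expr1n mul1r opprK.
  by rewrite -[1 + 1]/2%:R mulVf ?pnatr_eq0.
transitivity (((1 - 'i) ^+ 2 * A ^+ 2 + (1 + 'i) ^+ 2 * B ^+ 2
   + 2 * (1 - 'i ^+ 2) * (A * B)) / 4); first by field.
by rewrite A2 B2 AB sqrrB sqrrD i2; field.
Qed.

Lemma flat_all_H n : flat C (@single_N n None) (@clique n) = ~~ odd n.
Proof.
apply/forallP/idP => [/(_ 0)|evn k]; last first.
  rewrite norm_eq1_sqr sqr_spectrum_all_H exprNn -signr_odd (negPf evn) mul1r.
  by rewrite subrr mulr0 !mul0r addr0 normr1.
rewrite norm_eq1_sqr sqr_spectrum_all_H; apply: contraTN => oddn.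
rewrite big1 => [|j _]; last by rewrite mxE.
rewrite exprNn -signr_odd oddn expr1 mulN1r mulr1.
have -> : 'i * (- 'i ^+ n - 'i ^+ n) / 2 = - 'i ^+ n.+1 :> C.
  by rewrite exprS; field.
(* As n + 1 is even, i^(n+1) is 1 or -1, so the squared entry at k = 0 is 0 or 2. *)
have -> : n.+1 = (n.+1./2 * 2)%N by rewrite -{1}(odd_double_half n.+1) /= oddn muln2.
rewrite mulnC exprM sqrCi -signr_odd.
case: (odd _); rewrite ?expr1 ?expr0 ?subrr ?normr0 ?opprK.
  by rewrite (normr_nat C 2) (eqr_nat C 2 1).
by rewrite eq_sym oner_eq0.
Qed.

Lemma num_flat_spectra_clique n :
  num_flat_spectra C [set GateH; GateN] (@clique n) = (n + ~~ odd n)%N.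
Proof.
have injS : injective (@single_N n).
  move=> [j|] [l|] // /ffunP e.
  - by have := e j; rewrite !ffunE eqxx; case: eqP => // ->.
  - by have := e j; rewrite !ffunE eqxx.
  - by have := e l; rewrite !ffunE eqxx.
rewrite /num_flat_spectra.
(* The flat choices are the n ones with a single N, together with the all-H choice when n is
   even. *)
transitivity #|single_N @: [set o : option 'I_n | isSome o || ~~ odd n]|; last first.
  rewrite card_imset //; case: (odd n) => /=.
    rewrite addn0 -[RHS]card_ord -[RHS](card_imset (f := Some) _ Some_inj).
    apply: eq_card => -[j|]; rewrite !inE /=; first by rewrite imset_f.
    by apply/esym/imsetP => -[].
  rewrite addn1 -[in RHS](card_ord n) -card_option; apply: eq_card => o.
  by rewrite !inE orbT.
apply: eq_card => U; rewrite inE; apply/andP/imsetP => [[HN fU]|[o]]; last first.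
  rewrite inE => Po ->; split.
    by apply/forallP => j; rewrite ffunE !inE; case: ifP; rewrite eqxx ?orbT.
  by case: o Po => [j|] /=; rewrite ?flat_single_N ?flat_all_H.
have notN j : U j != GateN -> U j = GateH.
  by move/forallP: HN => /(_ j); rewrite !inE; case/orP => /eqP -> //; rewrite eqxx.
case: (pickP (fun j => U j == GateN)) => [j /eqP Uj|noN].
  exists (Some j); first by rewrite inE.
  apply/ffunP => i; rewrite ffunE (inj_eq Some_inj); case: eqP => [<- //|/eqP ji].
  (* A second N at [i] would contradict flatness. *)
  by apply: notN; apply: contraL fU => /eqP; apply: not_flat_two_N ji Uj.
have UE : U = single_N None.
  by apply/ffunP => i; rewrite ffunE; apply: notN; rewrite noN.
by exists None; rewrite // inE -flat_all_H -UE.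
Qed.

End CliqueSpectrum.

Theorem lemma2 (R : realType) :
  (forall n : nat, (2 <= n)%N ->
     (K R n)%:R = (K R (n - 1))%:R + 1 + (- 1) ^+ n :> rat) /\
  (forall n : nat, (1 <= n)%N ->
     (K R n)%:R = n%:R + (1 + (- 1) ^+ n) / 2 :> rat).
Proof.
(* (1 + (-1)^n) / 2 is the indicator of even n; the recurrence is the difference of two consecutive
   closed forms. *)
have KE n : (K R n)%:R = n%:R + (1 + (- 1) ^+ n) / 2 :> rat.
  rewrite /K num_flat_spectra_clique natrD -signr_odd.
  by case: (odd n); rewrite /= ?expr0 ?expr1; congr (_ + _); field.
split=> [[//|n] _|n _]; last exact: KE.
by rewrite subSS subn0 !KE exprS -natr1; field.
Qed.
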